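(* Let $R$ be a (commutative, unital) semiprimitive $f$-ring with bounded inversion. Then the lattice $BZ(R)$ is co-normal if and only if $R$ is a $UPW$-ring.
   Context: An $f$-ring is a lattice-ordered ring $A$ such that $c(a\vee b)=(ca)\vee(cb)$ for all $a,b\in A$ and $c\ge 0$; it has bounded inversion if every element $\geq 1$ is invertible. A ring is semiprimitive if the intersection of all its maximal ideals is zero. For $a\in R$, $M_a$ is the intersection of all maximal ideals of $R$ containing $a$ (with $M_a=R$ if there are none). For such $R$, $BZ(R)=\{M_a: a\in R\}$, partially ordered by inclusion, is a distributive lattice with $M_a\vee M_b=M_{a^2+b^2}$ and $M_a\wedge M_b=M_{ab}$, bottom element $M_0=0$ and top element $M_1=R$. A bounded distributive lattice $L$ is co-normal if for all $a,b\in L$ with $a\wedge b=0$ there exist $x,y\in L$ with $x\vee y=1$ and $x\wedge a=y\wedge b=0$. $R$ is a $UPW$-ring if for all $a,b\in R$ with $aR\cap bR=0$ the ideal $\mathrm{Ann}(a)+\mathrm{Ann}(b)$ contains a unit, where $\mathrm{Ann}(a)=\{r\in R: ra=0\}$. *)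

(* Defs.v *)
From HB Require Import structures.
From mathcomp Require Import all_boot all_order all_algebra.
From mathcomp Require Import boolp classical_sets.

Set Implicit Arguments.
Unset Strict Implicit.
Unset Printing Implicit Defensive.

Import Order.TTheory GRing.Theory Num.Theory.
Local Open Scope classical_set_scope.
Local Open Scope ring_scope.

(* All rings are commutative and unital; the zero ring is allowed, hence
   comPzRingType. *)

(* The lattice order is a second structure on the carrier of the ring and not
   an HB join: such a structure would need a common ancestor with
   realDomainType above rings and lattices, which the library lacks. *)
Structure fRingType := FRing {
  fring_ring :> comPzRingType;
  fring_lattice : Order.Lattice ring_display fring_ring;
  fring_leD2r : let le := @Order.le _ (Order.Lattice.Pack fring_lattice) in
    forall c a b : fring_ring, le a b -> le (a + c) (b + c);
  fring_mulr_ge0 : let le := @Order.le _ (Order.Lattice.Pack fring_lattice) in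
    forall a b : fring_ring, le 0 a -> le 0 b -> le 0 (a * b);
  fring_mulr_join :
    let le := @Order.le _ (Order.Lattice.Pack fring_lattice) in
    let join := @Order.join _ (Order.Lattice.Pack fring_lattice) in
    forall a b c : fring_ring, le 0 c ->
      c * join a b = join (c * a) (c * b)
}.

Definition lat (R : fRingType) : latticeType ring_display :=
  Order.Lattice.Pack (fring_lattice R).

Local Notation "x <=l y" := (@Order.le ring_display (lat _) x y) (at level 70).
Local Notation ljoin := (@Order.join ring_display (lat _)).
Local Notation lmeet := (@Order.meet ring_display (lat _)).

(* GRing.unit is not available on a comPzRingType. *)
Definition invertible (R : comPzRingType) (a : R) : Prop :=
  exists b : R, a * b = 1.

Definition bounded_inversion (R : fRingType) : Prop :=
  forall a : R, 1 <=l a -> invertible a.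

(* Unlike idealr_closed, this does not require properness. *)
Definition ideal (R : comPzRingType) (I : set R) : Prop :=
  [/\ I 0, forall a b, I a -> I b -> I (a + b) & forall r a, I a -> I (r * a)].

Definition maximal_ideal (R : comPzRingType) : set (set R) :=
  [set m | [/\ ideal m, m != setT &
     forall J : set R, ideal J -> m `<=` J -> J = m \/ J = setT]].

Definition semiprimitive (R : comPzRingType) : Prop :=
  \bigcap_(m in @maximal_ideal R) m = [set 0].

(* An intersection over the empty family is setT. *)
Definition Mset (R : comPzRingType) (a : R) : set R :=
  \bigcap_(m in [set m | maximal_ideal m /\ m a]) m.

Definition Ann (R : comPzRingType) (a : R) : set R := [set r | r * a = 0].

Definition principal (R : comPzRingType) (a : R) : set R :=
  [set a * r | r in setT].

Definition UPW_ring (R : comPzRingType) : Prop :=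
  forall a b : R, principal a `&` principal b = [set 0] ->
  exists2 u : R, invertible u & [set r + s | r in Ann a & s in Ann b] u.

Definition co_normal d (L : tbDistrLatticeType d) : Prop :=
  forall a b : L, Order.meet a b = \bot%O ->
  exists x y : L, [/\ Order.join x y = \top%O,
                      Order.meet x a = \bot%O & Order.meet y b = \bot%O].

(* BZ(R) as a type, ordered by inclusion. The proof of bounded inversion is a
   parameter because the existence of joins depends on it. *)
Definition BZ (R : fRingType) (biR : bounded_inversion R) : Type :=
  {A : set R | `[< exists a : R, A = Mset a >]}.

HB.instance Definition _ R biR := [isSub of @BZ R biR for sval].
HB.instance Definition _ R biR := [Choice of @BZ R biR by <:].
HB.instance Definition _ R biR :=
  [SubChoice_isSubPOrder of @BZ R biR by <: with set_display].

Lemma BZ_leE (R : fRingType) (biR : bounded_inversion R) (A B : BZ biR) :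
  (A <= B)%O = (val A `<=` val B) :> Prop.
Proof. by rewrite leEsub subsetEset. Qed.

Lemma Mset_BZ (R : comPzRingType) (a : R) :
  `[< exists b : R, Mset a = Mset b >].
Proof. by apply/asboolP; exists a. Qed.

Definition BZ_of (R : fRingType) (biR : bounded_inversion R) (a : R) : BZ biR :=
  exist _ (Mset a) (Mset_BZ a).

Definition BZ_repr (R : fRingType) (biR : bounded_inversion R) (A : BZ biR) : R :=
  sval (cid (asboolW (valP A))).

Lemma BZ_reprK (R : fRingType) (biR : bounded_inversion R) :
  cancel (@BZ_repr R biR) (BZ_of biR).
Proof.
by move=> A; apply: val_inj; rewrite /= /BZ_repr; case: cid => a /= <-.
Qed.

Definition BZ_meet (R : fRingType) (biR : bounded_inversion R) (A B : BZ biR) :=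
  BZ_of biR (BZ_repr A * BZ_repr B).

Definition BZ_join (R : fRingType) (biR : bounded_inversion R) (A B : BZ biR) :=
  BZ_of biR (BZ_repr A ^+ 2 + BZ_repr B ^+ 2).

Lemma Mset_le (R : comPzRingType) (a b : R) :
  Mset a `<=` Mset b <-> forall m, maximal_ideal m -> m b -> m a.
Proof.
split=> [ab m mm mb|ab x ax m [mm mb]]; last by apply: ax; split=> //; exact: ab.
by apply: (ab a _ m) => // n [].
Qed.

Lemma ideal_adjoin (R : comPzRingType) (m : set R) (a : R) :
  ideal m -> ideal [set x | exists2 r, m r & exists s, x = r + s * a].
Proof.
move=> [m0 mD mM]; split=> /=.
- by exists 0 => //; exists 0; rewrite mul0r addr0.
- move=> _ _ [r mr [s ->]] [t mt [u ->]]; exists (r + t); first exact: mD.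
  by exists (s + u); rewrite mulrDl addrACA.
- move=> t _ [r mr [s ->]]; exists (t * r); first exact: mM.
  by exists (t * s); rewrite mulrDr mulrA.
Qed.

Lemma maximal_ideal_inv (R : comPzRingType) (m : set R) (a : R) :
  maximal_ideal m -> ~ m a -> exists2 r, m r & exists s, 1 = r + s * a.
Proof.
move=> [im mT mmax] ma; have [m0 mD mM] := im.
case: (mmax _ (ideal_adjoin a im)).
- by move=> x mx; exists x => //; exists 0; rewrite mul0r addr0.
- move=> E; case: ma; rewrite -E /=; exists 0 => //; exists 1.
  by rewrite add0r mul1r.
- by move=> E; have : [set: R] 1 by []; rewrite -E.
Qed.

Lemma maximal_idealN1 (R : comPzRingType) (m : set R) :
  maximal_ideal m -> ~ m 1.
Proof.
move=> [[m0 mD mM] /eqP mT _] m1; apply: mT; apply/seteqP; split=> // x _.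
by rewrite -[x]mulr1; exact: mM.
Qed.

Lemma maximal_idealM (R : comPzRingType) (m : set R) (a b : R) :
  maximal_ideal m -> m (a * b) <-> m a \/ m b.
Proof.
move=> mm; have [[m0 mD mM] _ _] := mm; split; last first.
  by case=> h; [rewrite mulrC|]; exact: mM.
move=> mab; have [ma|ma] := pselect (m a); [by left | right].
have [r mr [s e]] := maximal_ideal_inv mm ma.
rewrite -[b]mul1r e mulrDl; apply: mD; first by rewrite mulrC; exact: mM.
by rewrite -mulrA; exact: mM.
Qed.

Lemma fring_sub_ge0 (R : fRingType) (a b : R) : (0 <=l b - a) = (a <=l b).
Proof.
apply/idP/idP => h; first by have := fring_leD2r a h; rewrite add0r subrK.
by have := fring_leD2r (- a) h; rewrite subrr.
Qed.

Lemma fring_oppr_le (R : fRingType) (a b : R) : (- a <=l - b) = (b <=l a).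
Proof. by rewrite -fring_sub_ge0 opprK addrC fring_sub_ge0. Qed.

Lemma fring_ler_wpM2l (R : fRingType) (c a b : R) :
  0 <=l c -> a <=l b -> c * a <=l c * b.
Proof.
move=> c0 ab; rewrite -fring_sub_ge0 -mulrBr.
by apply: fring_mulr_ge0 => //; rewrite fring_sub_ge0.
Qed.

(* With u = a \/ 0 and v = (- a) \/ 0 one has a = u - v and u * v = 0. *)
Lemma fring_sqr_ge0 (R : fRingType) (a : R) : 0 <=l a ^+ 2.
Proof.
pose u : R := ljoin a 0; pose v : R := u - a.
have u0 : 0 <=l u by exact: leUr.
have v0 : 0 <=l v by rewrite fring_sub_ge0; exact: leUl.
have uv_disj w : w <=l u -> w <=l v -> w <=l 0.
  move=> wu wv; have : u <=l u - w.
    rewrite leUx; apply/andP; split; last by rewrite fring_sub_ge0.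
    by rewrite -fring_sub_ge0 addrAC fring_sub_ge0.
  by rewrite -fring_sub_ge0 addrAC subrr add0r -{1}oppr0 fring_oppr_le.
have joinNE (x y : R) : lmeet x y = - ljoin (- x) (- y).
  apply/le_anti/andP; split.
    rewrite -fring_oppr_le opprK leUx !fring_oppr_le.
    by apply/andP; split; [exact: leIl | exact: leIr].
  rewrite lexI; apply/andP; split.
    by rewrite -fring_oppr_le opprK; exact: leUl.
  by rewrite -fring_oppr_le opprK; exact: leUr.
have mulI (c x y : R) : 0 <=l c ->
    c * lmeet x y = lmeet (c * x) (c * y).
  by move=> c0; rewrite !joinNE mulrN fring_mulr_join // !mulrN.
have disjM (c x y : R) : 0 <=l c -> 0 <=l x -> 0 <=l y ->
    lmeet x y <=l 0 -> lmeet (c * x) y <=l 0.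
  move=> c0 x0 y0 xy; pose d : R := ljoin c 1.
  have d0 : 0 <=l d by apply: le_trans c0 _; exact: leUl.
  have : lmeet (c * x) y <=l d * lmeet x y.
    rewrite mulI //; apply: leI2.
      by rewrite ![_ * x]mulrC; apply: fring_ler_wpM2l => //; exact: leUl.
    rewrite -{1}[y]mulr1 [d * y]mulrC.
    by apply: fring_ler_wpM2l => //; exact: leUr.
  move/le_trans; apply; rewrite -[leRHS](mulr0 d).
  exact: fring_ler_wpM2l.
have uvle0 : u * v <=l 0.
  have h1 : lmeet (v * u) v <=l 0.
    by apply: disjM => //; apply: uv_disj; [exact: leIl | exact: leIr].
  have vu0 : 0 <=l v * u by exact: fring_mulr_ge0.
  have h2 : lmeet (u * v) (v * u) <=l 0.
    by apply: disjM => //; rewrite meetC.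
  by rewrite [v * u]mulrC meetxx in h2.
have uv : u * v = 0.
  by apply/(@le_anti _ (lat R)); rewrite uvle0; exact: fring_mulr_ge0.
have -> : a = u - v by rewrite /v opprB addrC subrK.
rewrite sqrrB uv mul0rn subr0; apply: (@le_trans _ (lat R) (v ^+ 2)).
  by rewrite expr2; exact: fring_mulr_ge0.
by rewrite -fring_sub_ge0 addrK expr2; exact: fring_mulr_ge0.
Qed.

Lemma maximal_ideal_sumsq (R : fRingType) (m : set R) (a b : R) :
  bounded_inversion R -> maximal_ideal m ->
  m (a ^+ 2 + b ^+ 2) <-> m a /\ m b.
Proof.
move=> biR mm; have [[m0 mD mM] _ _] := mm.
have key x y : m (x ^+ 2 + y ^+ 2) -> m x.
  move=> mxy; apply: contrapT => mx.
  have [r mr [s e]] := maximal_ideal_inv mm mx.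
  have mq : m (1 + (s * y) ^+ 2).
    have -> : 1 + (s * y) ^+ 2 = (1 + s * x) * r + s ^+ 2 * (x ^+ 2 + y ^+ 2).
      have -> : r = 1 - s * x by rewrite e addrK.
      by rewrite [_ * (1 - _)]mulrC -subr_sqr expr1n mulrDr -!exprMn addrA subrK.
    by apply: mD; exact: mM.
  have [|t ht] := biR (1 + (s * y) ^+ 2).
    by rewrite -fring_sub_ge0 addrC addKr fring_sqr_ge0.
  by apply: (maximal_idealN1 mm); rewrite -ht mulrC; exact: mM.
split=> [h|[ma mb]].
  by split; [exact: key h | apply: (key b a); rewrite addrC].
by apply: mD; rewrite expr2; exact: mM.
Qed.

Lemma BZ_of_le (R : fRingType) (biR : bounded_inversion R) (a b : R) :
  (BZ_of biR a <= BZ_of biR b)%O <-> forall m, maximal_ideal m -> m b -> m a.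
Proof. by rewrite BZ_leE; exact: Mset_le. Qed.

Lemma BZ_lexI (R : fRingType) (biR : bounded_inversion R) (C A B : BZ biR) :
  (C <= BZ_meet A B)%O = (C <= A)%O && (C <= B)%O.
Proof.
rewrite -(BZ_reprK C) -[in RHS](BZ_reprK A) -[in RHS](BZ_reprK B) /BZ_meet.
apply/idP/andP => [/BZ_of_le h|[/BZ_of_le hA /BZ_of_le hB]].
  by split; apply/BZ_of_le => m mm mx; apply: h => //;
     apply/maximal_idealM => //; [left | right].
by apply/BZ_of_le => m mm /(maximal_idealM _ _ mm)[]; [exact: hA | exact: hB].
Qed.

Lemma BZ_leUx (R : fRingType) (biR : bounded_inversion R) (A B C : BZ biR) :
  (BZ_join A B <= C)%O = (A <= C)%O && (B <= C)%O.
Proof.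
rewrite -(BZ_reprK C) -[in RHS](BZ_reprK A) -[in RHS](BZ_reprK B) /BZ_join.
apply/idP/andP => [/BZ_of_le h|[/BZ_of_le hA /BZ_of_le hB]].
  by split; apply/BZ_of_le => m mm mx;
     have /(maximal_ideal_sumsq _ _ biR mm)[] := h m mm mx.
apply/BZ_of_le => m mm mx; apply/(maximal_ideal_sumsq _ _ biR mm).
by split; [exact: hA | exact: hB].
Qed.

HB.instance Definition _ R biR :=
  Order.POrder_isMeetSemilattice.Build set_display (@BZ R biR)
    (@BZ_lexI R biR).
HB.instance Definition _ R biR :=
  Order.POrder_isJoinSemilattice.Build set_display (@BZ R biR)
    (@BZ_leUx R biR).

Lemma BZ_meetE (R : fRingType) (biR : bounded_inversion R) (a b : R) :
  Order.meet (BZ_of biR a) (BZ_of biR b) = BZ_of biR (a * b).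
Proof.
apply/le_anti/andP; split.
  apply/BZ_of_le => m mm.
  have /BZ_of_le ha : (BZ_of biR (BZ_repr (BZ_of biR a)) <= BZ_of biR a)%O.
    by rewrite BZ_reprK.
  have /BZ_of_le hb : (BZ_of biR (BZ_repr (BZ_of biR b)) <= BZ_of biR b)%O.
    by rewrite BZ_reprK.
  by move=> /(maximal_idealM _ _ mm)[] h; apply/(maximal_idealM _ _ mm);
     [left; exact: ha | right; exact: hb].
by rewrite lexI; apply/andP; split; apply/BZ_of_le => m mm h;
   apply/(maximal_idealM _ _ mm); [left | right].
Qed.

Lemma BZ_joinE (R : fRingType) (biR : bounded_inversion R) (a b : R) :
  Order.join (BZ_of biR a) (BZ_of biR b) = BZ_of biR (a ^+ 2 + b ^+ 2).
Proof.
apply/le_anti/andP; split.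
  by rewrite leUx; apply/andP; split; apply/BZ_of_le => m mm;
     move=> /(maximal_ideal_sumsq _ _ biR mm)[].
have /BZ_of_le ha : (BZ_of biR a <= BZ_of biR (BZ_repr (BZ_of biR a)))%O.
  by rewrite BZ_reprK.
have /BZ_of_le hb : (BZ_of biR b <= BZ_of biR (BZ_repr (BZ_of biR b)))%O.
  by rewrite BZ_reprK.
apply/BZ_of_le => m mm /(maximal_ideal_sumsq _ _ biR mm)[h1 h2].
by apply/(maximal_ideal_sumsq _ _ biR mm); split; [exact: ha | exact: hb].
Qed.

Lemma BZ_meetUl (R : fRingType) (biR : bounded_inversion R) :
  @left_distributive (BZ biR) (BZ biR) Order.meet Order.join.
Proof.
move=> A B C; rewrite -(BZ_reprK A) -(BZ_reprK B) -(BZ_reprK C).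
move: (BZ_repr A) (BZ_repr B) (BZ_repr C) => a b c.
rewrite BZ_joinE !BZ_meetE BZ_joinE; apply/le_anti/andP; split.
  apply/BZ_of_le => m mm.
  move=> /(maximal_ideal_sumsq _ _ biR mm)[].
  move=> /(maximal_idealM _ _ mm) h1 /(maximal_idealM _ _ mm) h2.
  apply/(maximal_idealM _ _ mm).
  by case: h1 => h1; [case: h2 => h2; [left|right] | right] => //;
     apply/(maximal_ideal_sumsq _ _ biR mm).
apply/BZ_of_le => m mm /(maximal_idealM _ _ mm) h.
apply/(maximal_ideal_sumsq _ _ biR mm).
case: h => [/(maximal_ideal_sumsq _ _ biR mm)[h1 h2]|h].
  by split; apply/(maximal_idealM _ _ mm); left.
by split; apply/(maximal_idealM _ _ mm); right.
Qed.

Lemma BZ_le0x (R : fRingType) (biR : bounded_inversion R) (A : BZ biR) :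
  (BZ_of biR 0 <= A)%O.
Proof. by rewrite -(BZ_reprK A); apply/BZ_of_le => m [[]]. Qed.

Lemma BZ_lex1 (R : fRingType) (biR : bounded_inversion R) (A : BZ biR) :
  (A <= BZ_of biR 1)%O.
Proof.
by rewrite -(BZ_reprK A); apply/BZ_of_le => m mm /(maximal_idealN1 mm).
Qed.

HB.instance Definition _ R biR :=
  Order.Lattice_Meet_isDistrLattice.Build set_display (@BZ R biR)
    (@BZ_meetUl R biR).
HB.instance Definition _ R biR :=
  Order.hasBottom.Build set_display (@BZ R biR) (@BZ_le0x R biR).
HB.instance Definition _ R biR :=
  Order.hasTop.Build set_display (@BZ R biR) (@BZ_lex1 R biR).

Lemma BZ_botE (R : fRingType) (biR : bounded_inversion R) :
  semiprimitive R -> val (\bot%O : BZ biR) = [set 0].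
Proof.
move=> <-; apply/seteqP; split=> x h m => [mm|[mm _]]; last exact: h.
by apply: h; split=> //; case: mm => -[].
Qed.

Lemma BZ_topE (R : fRingType) (biR : bounded_inversion R) :
  val (\top%O : BZ biR) = setT.
Proof. by apply/seteqP; split=> // x _ m [/maximal_idealN1]. Qed.

(* Main.v *)
Require Import Defs.
From mathcomp Require Import all_boot all_order all_algebra.
From mathcomp Require Import boolp classical_sets.

(* Semiprimitivity gives [M_a = 0 <-> a = 0] and, the ring being reduced,
   [aR `&` bR = 0 <-> a * b = 0]; dually, [M_a = R] exactly when [a] is
   invertible. Co-normality of BZ(R) thus says that [a * b = 0] yields [x] in
   Ann(a) and [y] in Ann(b) with [x ^+ 2 + y ^+ 2] invertible. Such a sum of
   squares is a unit of Ann(a) + Ann(b); conversely, if [x + y] is a unit then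
   so is [x ^+ 2 + y ^+ 2], since a maximal ideal containing the latter contains
   both [x] and [y]. *)

Import Order.TTheory GRing.Theory.
Local Open Scope classical_set_scope.
Local Open Scope ring_scope.

Lemma principal_ideal (R : comPzRingType) (a : R) : ideal (principal a).
Proof.
split.
- by exists 0 => //; rewrite mulr0.
- by move=> _ _ [r _ <-] [s _ <-]; exists (r + s) => //; rewrite mulrDr.
- by move=> t _ [r _ <-]; exists (t * r) => //; rewrite mulrCA.
Qed.

(** Zorn's lemma on the ideals that contain [a] and miss [1]; missing [1] expresses properness and
    survives unions of chains. *)
Lemma maximal_ideal_exists {R : comPzRingType} {a : R} :
  ~ invertible a -> exists2 m, maximal_ideal m & m a.
Proof.
move=> aN.
(* [set0] is allowed because [Zorn_bigcup] also asks for the empty chain. *)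
pose P (X : set R) := X = set0 \/ [/\ ideal X, X a & ~ X 1].
have [F FP Ftot|A [PA Amax]] := @Zorn_bigcup _ P.
- have [[X FX X0]|Fempty] :=
      pselect (exists2 X, F X & X <> set0); last first.
    left; rewrite -subset0 => x [X FX Xx]; apply: Fempty; exists X => // X0.
    by rewrite X0 in Xx.
  have Fid Y y : F Y -> Y y -> [/\ ideal Y, Y a & ~ Y 1].
    by move=> FY Yy; case: (FP Y FY) => // Y0; rewrite Y0 in Yy.
  right; split.
  + split.
    * by case: (FP X FX) => // -[[X0' _ _] _ _]; exists X.
    * move=> x y [Y FY Yx] [Z FZ Zy].
      have [[_ YD _] _ _] := Fid _ _ FY Yx.
      have [[_ ZD _] _ _] := Fid _ _ FZ Zy.
      case: (Ftot _ _ FY FZ) => YZ; [exists Z|exists Y] => //.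
        by apply: ZD => //; exact: YZ.
      by apply: YD => //; exact: YZ.
    * move=> r x [Y FY Yx]; exists Y => //.
      by have [[_ _ YM] _ _] := Fid _ _ FY Yx; exact: YM.
  + by case: (FP X FX) => // -[_ Xa _]; exists X.
  + by move=> [Y FY Y1]; have [_ _] := Fid _ _ FY Y1.
- have pa : principal a a by exists 1 => //; rewrite mulr1.
  case: PA => [A0|[iA Aa A1]].
    (* The maximal element is not [set0]: [principal a] lies strictly above it and misses [1]
       because [a] is not invertible. *)
    case: (Amax (principal a)).
      by rewrite A0; split=> // /(_ a pa).
    right; split=> //; first exact: principal_ideal.
    by move=> [r _ ar]; apply: aN; exists r.
  exists A => //; split=> //.
    by apply/eqP => AT; apply: A1; rewrite AT.
  move=> J iJ AJ; have [J1|J1] := pselect (J 1).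
    right; apply/seteqP; split=> // x _.
    by have [_ _ JM] := iJ; rewrite -[x]mulr1; exact: JM.
  left; apply/seteqP; split=> //; apply: contrapT => JA.
  by apply: (Amax J) => //; right; split=> //; exact: AJ.
Qed.

Lemma invertible_maximal (R : comPzRingType) (a : R) :
  invertible a <-> forall m, maximal_ideal m -> ~ m a.
Proof.
split=> [[b ab] m mm ma|aN].
  apply: (maximal_idealN1 mm); rewrite -ab.
  by apply/(maximal_idealM _ _ mm); left.
by apply: contrapT => /maximal_ideal_exists[m mm]; exact: aN.
Qed.

(** Every maximal ideal contains [0], so the inclusion of [Mset a] in [Mset 0] puts [a] in all of
    them. *)
Lemma BZ_of_eq0 (R : fRingType) (biR : bounded_inversion R) (a : R) :
  semiprimitive R -> BZ_of biR a = \bot%O <-> a = 0.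
Proof.
move=> spR; split=> [a0|->] //.
have /BZ_of_le aJ : (BZ_of biR a <= BZ_of biR 0)%O by rewrite a0 le0x.
suff : [set (0 : R)] a by [].
by rewrite -spR => m mm; apply: aJ => //; case: mm => -[].
Qed.

(** The inclusion of [Mset 1] in [Mset a] puts [1] in every maximal ideal containing [a], so there
    is none. *)
Lemma BZ_of_eq1 (R : fRingType) (biR : bounded_inversion R) (a : R) :
  BZ_of biR a = \top%O <-> invertible a.
Proof.
rewrite invertible_maximal; split=> [a1 m mm ma|aN].
  have /BZ_of_le h : (BZ_of biR 1 <= BZ_of biR a)%O by rewrite a1 lex1.
  exact: maximal_idealN1 mm (h m mm ma).
apply/le_anti; rewrite lex1 /=.
by apply/BZ_of_le => m mm /(aN m mm).
Qed.

(** Maximal ideals are prime, so each contains [a] along with [a ^+ 2]. *)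
Lemma semiprimitive_reduced (R : comPzRingType) (a : R) :
  semiprimitive R -> a ^+ 2 = 0 -> a = 0.
Proof.
move=> spR a2; suff : [set (0 : R)] a by [].
rewrite -spR => m mm; have : m (a * a).
  by rewrite -expr2 a2; case: mm => -[].
by case/(maximal_idealM _ _ mm).
Qed.

Lemma principal_disjoint (R : comPzRingType) (a b : R) :
  semiprimitive R ->
  principal a `&` principal b = [set 0] <-> a * b = 0.
Proof.
move=> spR; split=> [ab|ab].
  suff : [set (0 : R)] (a * b) by [].
  by rewrite -ab; split; [exists b | exists a => //; rewrite mulrC].
apply/seteqP; split=> [x [[r _ ar] [s _ bs]]|_ ->].
  (* As [x] is both [a * r] and [b * s], its square is a multiple of [a * b]. *)
  apply: semiprimitive_reduced => //.
  by rewrite expr2 -{1}ar -bs mulrACA ab mul0r.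
by split; [case: (principal_ideal R a) | case: (principal_ideal R b)].
Qed.

Theorem proposition4p15 (R : fRingType) (biR : bounded_inversion R)
    (spR : semiprimitive R) :
  co_normal (BZ biR) <-> UPW_ring R.
Proof.
split=> [cn a b /(principal_disjoint _ _ _ spR) ab|upw A B].
  have [|X [Y []]] := cn (BZ_of biR a) (BZ_of biR b).
    by rewrite BZ_meetE; apply/BZ_of_eq0.
  rewrite -(BZ_reprK X) -(BZ_reprK Y) BZ_joinE !BZ_meetE.
  move: (BZ_repr X) (BZ_repr Y) => x y.
  move=> /BZ_of_eq1 xyu /(BZ_of_eq0 _ _ _ spR) xa /(BZ_of_eq0 _ _ _ spR) yb.
  (* The unit supplied by the join already splits along the two annihilators. *)
  exists (x ^+ 2 + y ^+ 2) => //; exists (x ^+ 2).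
    by rewrite /Ann /= expr2 -mulrA xa mulr0.
  by exists (y ^+ 2) => //; rewrite /Ann /= expr2 -mulrA yb mulr0.
rewrite -(BZ_reprK A) -(BZ_reprK B) BZ_meetE.
move: (BZ_repr A) (BZ_repr B) => a b /(BZ_of_eq0 _ _ _ spR) ab.
have [|u /invertible_maximal uN [x xa [y yb xyu]]] := upw a b.
  exact/principal_disjoint.
exists (BZ_of biR x), (BZ_of biR y); rewrite BZ_joinE !BZ_meetE; split.
- apply/BZ_of_eq1/invertible_maximal => m mm.
  move=> /(maximal_ideal_sumsq _ _ biR mm)[mx my]; apply: (uN m mm).
  by rewrite -xyu; have [[_ mD _] _ _] := mm; exact: mD.
- exact/BZ_of_eq0.
- exact/BZ_of_eq0.
Qed.
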